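(* Let $a>0$ and $E=[-a,a]\subset\mathbb{R}\subset\mathbb{C}$. Let $C_{[-a,a]}$ be the smallest constant $C>0$ such that $$\|q\|_{[-a,a]} \le C^n \,\|p\|_{[-a,a]}, \qquad n=\deg p,$$ holds for every monic polynomial $p$ with complex coefficients and every monic factor $q$ of $p$. Then $$C_{[-a,a]} = \begin{cases} \dfrac{2}{a}, & 0< a \le 1/2, \\[2ex] \dfrac{2}{a} \exp \left( \displaystyle\int_{1-a}^a \frac{\log(t+a)}{\pi\sqrt{a^2-t^2}}\, dt \right), & a>1/2. \end{cases}$$
   Context: For a compact set $E\subset\mathbb{C}$, $\|f\|_E = \sup_{z\in E}|f(z)|$. A monic factor of a monic polynomial $p$ is a monic complex polynomial $q$ such that $p=qr$ for some (monic) complex polynomial $r$. *)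

(* Defs.v *)
From HB Require Import structures.
From mathcomp Require Import all_boot all_order all_algebra.
From mathcomp Require Import all_classical all_reals all_analysis.
From mathcomp Require Import complex.

Set Implicit Arguments.
Unset Strict Implicit.
Unset Printing Implicit Defensive.

Import Order.TTheory GRing.Theory Num.Theory.

Local Open Scope classical_set_scope.
Local Open Scope ring_scope.
Local Open Scope complex_scope.

(* The norm of R[i] takes its values in R[i]; complex.Re brings it back to R. *)
Definition sup_norm (R : realType) (E : set R[i]) (f : R[i] -> R[i]) : R :=
  sup [set complex.Re `|f z| | z in E].

Definition poly_norm (R : realType) (E : set R[i]) (p : {poly R[i]}) : R :=
  sup_norm E (fun z => p.[z]).

Definition real_segment (R : realType) (a b : R) : set R[i] :=
  [set x%:C | x in `[a, b]].

Definition monic_factor (R : realType) (q p : {poly R[i]}) : Prop :=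
  q \is monic /\ exists r : {poly R[i]}, r \is monic /\ p = q * r.

(* For a monic p, (size p).-1 is the degree of p. *)
Definition factor_constants (R : realType) (E : set R[i]) : set R :=
  [set C | 0 < C /\
    forall p q : {poly R[i]}, p \is monic -> monic_factor q p ->
      poly_norm E q <= C ^+ (size p).-1 * poly_norm E p].

Definition is_smallest_factor_constant (R : realType) (E : set R[i]) (C : R) :
    Prop :=
  factor_constants E C /\ lbound (factor_constants E) C.

(* Main.v *)
Require Import Defs.
From HB Require Import structures.
From mathcomp Require Import all_boot all_order all_algebra.
From mathcomp Require Import all_classical all_reals all_analysis.
From mathcomp Require Import measurable_realfun complex ring lra.

Import Order.TTheory GRing.Theory Num.Theory.
Import numFieldNormedType.Exports.
Import ComplexField.Normc.

Local Open Scope classical_set_scope.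
Local Open Scope ring_scope.

(** Let [t_m = a cos th_m], [th_m = (2m+1) pi / (2n)], be the Chebyshev nodes and
    [W] the monic Chebyshev polynomial, [W (a cos t) = 2 (a/2)^n cos (n t)].
    If [b] is not real and [deg P < n], Lagrange interpolation at the nodes
    gives [|P(b)| <= K_b ||P|| (2/a)^n |W(b)|] with [K_b] independent of [n].
    Apply this to the powers of [p] and multiply over the roots [b] of
    [B = (X - x)^N - i r^N], which are never real: on both sides the product
    over [b] becomes a product of values of [B], at the roots of [p] on the left
    and at the nodes on the right. As [|B(z)|] is about [max(r, |x - z|)^N],
    removing the constants by letting the power of [p] and then [N] tend to
    infinity, and then [r] to 1, yields
      [prod_z max(1, |x - z|) <= ||p|| ((2/a) exp (J x))^(deg p)],
    where [z] runs over the roots of [p] and [J x] is the mean of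
    [log+ |x - a cos t|]. The left side bounds [|q(x)|] for each factor [q].
    For [x = - a cos s], the identity
      [(cos s + cos t)^2 = (1 + cos (s + t)) (1 + cos (s - t))]
    bounds [2 log+ |x - a cos t|] by [log+ (a + a cos (s + t)) +
    log+ (a + a cos (s - t))], so that [J x <= J (- a)]. Finally [J (- a)] is the
    integral of the statement, and [p = W] with
    [q = prod_(a + t_m >= 1) (X - t_m)], evaluated at [- a], shows that the
    constant is optimal. *)

(** * Interpolation at the Chebyshev nodes *)

(** The interpolant [Q] agrees with [P] at the distinct points of [s], and both have size at most
    [size s], so they are equal. Writing the cofactor at [b] as [W.[b] / (b - x)] gives all terms
    the common factor [W.[b]]. *)
Lemma horner_lagrange (F : fieldType) (s : seq F) (P : {poly F}) (b : F) :
  uniq s -> (size P <= size s)%N -> b \notin s ->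
  let W := \prod_(x <- s) ('X - x%:P) in
  P.[b] = \sum_(x <- s) P.[x] / W^`().[x] * (W.[b] / (b - x)).
Proof.
move=> us sP bs W.
pose V x := \prod_(y <- s | y != x) ('X - y%:P).
have WV x : x \in s -> W = ('X - x%:P) * V x by move=> xs; rewrite /W (bigD1_seq x).
have VE x y : (V x).[y] = \prod_(z <- s | z != x) (y - z).
  by rewrite horner_prod; apply: eq_bigr => z _; rewrite !hornerE.
have W'V x : x \in s -> W^`().[x] = (V x).[x].
  by move=> xs; rewrite (WV x xs) derivM derivXsubC !hornerE subrr mul0r addr0.
have Vx0 x : (V x).[x] != 0.
  rewrite VE prodf_seq_neq0; apply/allP => z _; apply/implyP.
  by rewrite subr_eq0 eq_sym.
have Vy0 x y : y \in s -> y != x -> (V x).[y] = 0.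
  move=> ys yx; rewrite VE; apply/eqP; rewrite prodf_seq_eq0.
  by apply/hasP; exists y => //; rewrite yx subrr eqxx.
have sV x : x \in s -> (size (V x) <= size s)%N.
  move=> xs; have := size_prod_XsubC s id; rewrite -/W (WV x xs).
  rewrite size_monicM ?monicXsubC //; first by rewrite size_XsubC => -[<-].
  by rewrite -size_poly_gt0 lt0n; apply: contraNneq (Vx0 x) => /eqP;
     rewrite size_poly_eq0 => /eqP ->; rewrite horner0.
pose Q := \sum_(x <- s) (P.[x] / W^`().[x]) *: V x.
have PQ : P = Q.
  apply/eqP; rewrite -subr_eq0; apply/eqP; apply: (roots_geq_poly_eq0 _ us).
    apply/allP => y ys; rewrite /root hornerD hornerN horner_sum (bigD1_seq y) //=.
    rewrite big1_seq ?addr0; last first.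
      by move=> x /andP[xy xs]; rewrite hornerZ Vy0 ?mulr0 // eq_sym.
    by rewrite hornerZ W'V // divfK // subrr.
  rewrite (leq_trans (size_polyD _ _)) // geq_max sP size_polyN.
  rewrite (leq_trans (size_sum _ _ _)) //; apply/bigmax_leqP_seq => x xs _.
  exact: leq_trans (size_scale_leq _ _) (sV x xs).
rewrite {1}PQ horner_sum; apply: eq_big_seq => x xs.
have bx : b - x != 0 by rewrite subr_eq0; apply: contraNneq bs => ->.
have -> : W.[b] = (b - x) * (V x).[b] by rewrite (WV x xs) hornerM hornerXsubC.
by rewrite hornerZ; congr (_ * _); rewrite mulrAC divff // mul1r.
Qed.


(* 2 c^n T_n(X / (2c)), which is monic for n > 0. *)
Fixpoint chebyshev (F : comNzRingType) (c : F) (n : nat) : {poly F} :=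
  if n is m.+1 then
    if m is k.+1 then 'X * chebyshev F c m - (c ^+ 2)%:P * chebyshev F c k
    else 'X
  else 2%:P.

Lemma chebyshevSS (F : comNzRingType) (c : F) n :
  chebyshev F c n.+2 =
  'X * chebyshev F c n.+1 - (c ^+ 2)%:P * chebyshev F c n.
Proof. by []. Qed.

(** The index starts at 1 because index 0 gives the constant 2. The induction carries a size bound
    on the preceding polynomial, so that the term with ['X] dominates the recurrence. *)
Lemma size_chebyshev (F : idomainType) (c : F) n :
  size (chebyshev F c n.+1) = n.+2 /\ chebyshev F c n.+1 \is monic.
Proof.
suff [] : (size (chebyshev F c n.+1) = n.+2 /\ chebyshev F c n.+1 \is monic) /\
  (size (chebyshev F c n) <= n.+1)%N by [].
elim: n => [|n [[sz mon] sz']].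
  by rewrite /= size_polyX monicX size_polyC; split=> //; case: eqP.
rewrite sz; split=> //.
have szX : size ('X * chebyshev F c n.+1) = n.+3.
  by rewrite mulrC size_mulX ?sz // -size_poly_gt0 sz.
have lt : (size (- ((c ^+ 2)%:P * chebyshev F c n))%R <
           size ('X * chebyshev F c n.+1)%R)%N.
  rewrite szX size_polyN mul_polyC.
  by rewrite (leq_ltn_trans (size_scale_leq _ _)) // (leq_ltn_trans sz').
rewrite chebyshevSS; split; first by rewrite size_polyDl.
by rewrite monicE lead_coefDl // lead_coefM lead_coefX mul1r -monicE.
Qed.

Lemma horner_chebyshev (R : realType) (a t : R) n :
  (chebyshev R (a / 2) n).[a * cos t] = 2 * (a / 2) ^+ n * cos (t *+ n).
Proof.
suff [] : (chebyshev R (a / 2) n).[a * cos t] = 2 * (a / 2) ^+ n * cos (t *+ n)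
  /\ (chebyshev R (a / 2) n.+1).[a * cos t]
     = 2 * (a / 2) ^+ n.+1 * cos (t *+ n.+1) by [].
elim: n => [|n [IH1 IH2]].
  by rewrite -[chebyshev _ _ 0]/(2%:P) -[chebyshev _ _ 1]/'X hornerC
     hornerX mulr0n mulr1n cos0 expr0 expr1 !mulr1; split=> //; field.
split=> //; rewrite chebyshevSS hornerD hornerN !hornerM hornerX hornerC IH1 IH2.
have -> : t *+ n = t *+ n.+1 - t by rewrite mulrSr addrK.
have -> : t *+ n.+2 = t *+ n.+1 + t by rewrite mulrSr.
by rewrite cosB cosD !exprS; field.
Qed.

(** This is the derivative in [t] of the preceding identity, obtained from the recurrence. Keeping
    [a * sin t] on the left avoids dividing by a sine that may vanish. *)
Lemma horner_deriv_chebyshev (R : realType) (a t : R) n :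
  (chebyshev R (a / 2) n)^`().[a * cos t] * (a * sin t) =
  2 * (a / 2) ^+ n * n%:R * sin (t *+ n).
Proof.
suff [] : (chebyshev R (a / 2) n)^`().[a * cos t] * (a * sin t) =
    2 * (a / 2) ^+ n * n%:R * sin (t *+ n)
  /\ (chebyshev R (a / 2) n.+1)^`().[a * cos t] * (a * sin t) =
    2 * (a / 2) ^+ n.+1 * n.+1%:R * sin (t *+ n.+1) by [].
elim: n => [|n [IH1 IH2]].
  by rewrite -[chebyshev _ _ 0]/(2%:P) -[chebyshev _ _ 1]/'X derivC derivX
     horner0 hornerC mulr0n mulr1n sin0 expr0 expr1 !mulr0
     mul0r mul1r !mulr1; split=> //; field.
split=> //; rewrite chebyshevSS derivB !derivM derivX derivC mul1r mul0r add0r.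
rewrite hornerD hornerN hornerD !hornerM hornerX hornerC.
rewrite mulrBl mulrDl -[a * cos t * _ * _]mulrA -[(a / 2) ^+ 2 * _ * _]mulrA.
rewrite IH1 IH2 horner_chebyshev.
have -> : t *+ n = t *+ n.+1 - t by rewrite mulrSr addrK.
have -> : t *+ n.+2 = t *+ n.+1 + t by rewrite mulrSr.
rewrite sinB sinD !exprS -(natr1 n.+1) -(natr1 n).
by field.
Qed.

(** For [m < n] these are the midpoints of the [n] equal subintervals of [[0, pi]], so node sums are
    also midpoint Riemann sums. Indices up to [2n] are used later, to go once around the circle. *)
Definition cheb_angle (R : realType) (n m : nat) : R :=
  (m.*2.+1)%:R * pi / n.*2%:R.

Definition cheb_node (R : realType) (a : R) (n m : nat) : R :=
  a * cos (cheb_angle R n m).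

Lemma cheb_angle_itv (R : realType) n m : (m < n)%N ->
  0 < cheb_angle R n m < pi.
Proof.
move=> mn; rewrite /cheb_angle; have pi0 := pi_gt0 R.
have n0 : 0 < n.*2%:R :> R by rewrite ltr0n double_gt0 (leq_ltn_trans _ mn).
apply/andP; split; first by rewrite divr_gt0 // mulr_gt0.
rewrite ltr_pdivrMr // mulrC ltr_pM2l // ltr_nat.
by rewrite -doubleS leq_double.
Qed.

Lemma cheb_angle_inj (R : realType) n i j : (i < n)%N ->
  cheb_angle R n i = cheb_angle R n j -> i = j.
Proof.
move=> lt_in /eqP; rewrite /cheb_angle.
have n0 : n.*2%:R != 0 :> R.
  by rewrite pnatr_eq0 -lt0n double_gt0 (leq_ltn_trans _ lt_in).
have pi0 : pi != 0 :> R by rewrite gt_eqF ?pi_gt0.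
rewrite (inj_eq (mulIf (invr_neq0 n0))) (inj_eq (mulIf pi0)) eqr_nat eqSS.
by move=> /eqP /double_inj.
Qed.

Lemma cheb_node_inj (R : realType) (a : R) n : a != 0 ->
  {in iota 0 n &, injective (cheb_node R a n)}.
Proof.
move=> a0 i j; rewrite !mem_iota /= add0n => ni nj /(mulfI a0) eq_cos.
apply: (cheb_angle_inj R n) => //; apply: cos_inj eq_cos.
  by have /andP[/ltW i0 /ltW ip] := cheb_angle_itv R _ _ ni; rewrite in_itv /= i0.
by have /andP[/ltW i0 /ltW ip] := cheb_angle_itv R _ _ nj; rewrite in_itv /= i0.
Qed.

Lemma cheb_angleMn (R : realType) n m : (0 < n)%N ->
  cheb_angle R n m *+ n = pi / 2 + pi *+ m.
Proof.
move=> n0; rewrite /cheb_angle -!mul2n !natrM -(mulr_natr _ n) -(mulr_natr pi).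
rewrite mul2n -natr1 -mul2n natrM.
by field; rewrite pnatr_eq0 -lt0n.
Qed.

Lemma cos_cheb_angle (R : realType) n m : (0 < n)%N ->
  cos (cheb_angle R n m *+ n) = 0.
Proof.
move=> n0; rewrite cheb_angleMn //; elim: m => [|m IH].
  by rewrite mulr0n addr0 cos_pihalf.
by rewrite [pi *+ _]mulrSr addrA cosDpi IH oppr0.
Qed.

Lemma norm_sin_cheb_angle (R : realType) n m : (0 < n)%N ->
  `|sin (cheb_angle R n m *+ n)| = 1.
Proof.
move=> n0; rewrite -sqrtr_sqr.
by rewrite sin2cos2 cos_cheb_angle // expr0n /= subr0 sqrtr1.
Qed.

Lemma chebyshev_prod (R : realType) (a : R) n : a != 0 -> (0 < n)%N ->
  chebyshev R (a / 2) n = \prod_(m <- iota 0 n) ('X - (cheb_node R a n m)%:P).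
Proof.
case: n => // n a0 _; have  [sz /monicP mon] := size_chebyshev R (a / 2) n.
rewrite (@all_roots_prod_XsubC _ (chebyshev R (a / 2) n.+1)
  [seq cheb_node R a n.+1 m | m <- iota 0 n.+1]).
- by rewrite mon scale1r big_map.
- by rewrite sz size_map size_iota.
- apply/allP => _ /mapP[m _ ->]; rewrite /root horner_chebyshev.
  by rewrite cos_cheb_angle // mulr0.
- by rewrite uniq_rootsE map_inj_in_uniq ?iota_uniq //; exact: cheb_node_inj.
Qed.

(** At a node [|sin (n t)| = 1], so the derivative formula fixes the product of [W'] with [a sin t],
    and the sine is at most 1 in modulus. *)
Lemma deriv_chebyshev_ge (R : realType) (a : R) n m : 0 < a -> (m < n)%N ->
  2 * (a / 2) ^+ n * n%:R / a <= `|(chebyshev R (a / 2) n)^`().[cheb_node R a n m]|.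
Proof.
move=> a0 mn; have n0 : (0 < n)%N by exact: leq_ltn_trans mn.
rewrite ler_pdivrMr //.
have : `|(chebyshev R (a / 2) n)^`().[cheb_node R a n m] *
    (a * sin (cheb_angle R n m))| = 2 * (a / 2) ^+ n * n%:R.
  rewrite horner_deriv_chebyshev normrM norm_sin_cheb_angle // mulr1 ger0_norm //.
  by rewrite !mulr_ge0 ?exprn_ge0 ?divr_ge0 ?ler0n // ltW.
move=> <-; rewrite normrM ler_wpM2l // normrM gtr0_norm // ger_pMr //.
exact: sin_max.
Qed.

Lemma norm_cheb_node (R : realType) (a : R) n m : 0 < a ->
  `|cheb_node R a n m| <= a.
Proof. by move=> a0; rewrite normrM gtr0_norm // ger_pMr // cos_max. Qed.

Lemma normc_opp (R : rcfType) (x : R[i]) : normc (- x) = normc x.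
Proof. exact: normcN. Qed.

Lemma normcB (R : rcfType) (x y : R[i]) : normc (x - y) = normc (y - x).
Proof. by rewrite -normc_opp opprB. Qed.

Lemma normcD_le (R : rcfType) (x y : R[i]) : normc (x + y) <= normc x + normc y.
Proof. exact: le_normcD. Qed.

Lemma normc_ge0 (R : rcfType) (x : R[i]) : 0 <= normc x.
Proof. by case: x => u v; exact: sqrtr_ge0. Qed.

Lemma normc_real (R : rcfType) (x : R) : normc (x%:C)%C = `|x|.
Proof. by rewrite /= expr0n /= addr0 sqrtr_sqr. Qed.

Lemma normc_ge_Im (R : rcfType) (x : R[i]) : `|complex.Im x| <= normc x.
Proof.
case: x => u v /=; rewrite -sqrtr_sqr; apply: ler_wsqrtr.
by rewrite lerDr sqr_ge0.
Qed.

Lemma normcX (R : rcfType) (x : R[i]) n : normc (x ^+ n) = normc x ^+ n.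
Proof.
elim: n => [|n IH]; first by rewrite !expr0; exact: normc1.
by rewrite !exprS normcM IH.
Qed.

Lemma normc_prod (R : rcfType) (I : Type) (s : seq I) (f : I -> R[i]) :
  normc (\prod_(i <- s) f i) = \prod_(i <- s) normc (f i).
Proof. by apply: (big_morph (@normc R) (@normcM R)); exact: normc1. Qed.

Lemma normc_sum_le (R : rcfType) (I : Type) (s : seq I) (f : I -> R[i]) :
  normc (\sum_(i <- s) f i) <= \sum_(i <- s) normc (f i).
Proof.
elim: s => [|i s IH]; first by rewrite !big_nil [normc _]normc0.
by rewrite !big_cons (le_trans (normcD_le _ _ _)) // lerD2l.
Qed.

(* A Bernstein-Walsh inequality, up to a constant independent of n. *)
Lemma normc_horner_le (R : realType) (a L : R) (P : {poly R[i]}) (b : R[i]) n :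
  0 < a -> (0 < n)%N -> (size P <= n)%N -> complex.Im b != 0 ->
  (forall m, (m < n)%N -> normc P.[(cheb_node R a n m)%:C%C] <= L) ->
  normc P.[b] <= L * (a / (2 * `|complex.Im b|)) * (2 / a) ^+ n *
    \prod_(m <- iota 0 n) normc (b - (cheb_node R a n m)%:C%C).
Proof.
move=> a0 n0 sP b0 PL.
have a_neq0 : a != 0 by rewrite gt_eqF.
pose t m : R[i] := (cheb_node R a n m)%:C%C.
have us : uniq [seq t m | m <- iota 0 n].
  rewrite map_inj_in_uniq ?iota_uniq // => i j Hi Hj [].
  exact: cheb_node_inj.
have bs : b \notin [seq t m | m <- iota 0 n].
  by apply/mapP => -[m _ bE]; rewrite bE /= eqxx in b0.
have := horner_lagrange _ _ P b us.
rewrite size_map size_iota => /(_ sP bs); cbv zeta; rewrite !big_map.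
have -> : \prod_(j <- iota 0 n) ('X - (t j)%:P) =
    map_poly (real_complex R) (chebyshev R (a / 2) n).
  rewrite chebyshev_prod // rmorph_prod; apply: eq_bigr => m _ /=.
  by rewrite rmorphB /= map_polyX map_polyC.
set W := map_poly _ _ => ->.
have WE : normc W.[b] = \prod_(m <- iota 0 n) normc (b - t m).
  rewrite /W chebyshev_prod // rmorph_prod horner_prod normc_prod.
  by apply: eq_bigr => m _ /=; rewrite rmorphB /= map_polyX map_polyC !hornerE.
apply: (le_trans (normc_sum_le _ _ _ _)).
have c0 : 0 < 2 * (a / 2) ^+ n * n%:R / a.
  by rewrite !(mulr_gt0, invr_gt0, exprn_gt0, divr_gt0) // ltr0n.
have L0 : 0 <= L by apply: le_trans (PL 0%N _); rewrite ?normc_ge0.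
have Ib0 : 0 < `|complex.Im b| by rewrite normr_gt0.
(* The nodes are real, so [|b - t_m|] is at least [|Im b|]. The factor [n] in the lower bound for
   [W'] compensates for the [n] summands, which makes the constant independent of [n]. *)
apply: (@le_trans _ _ (\sum_(m <- iota 0 n)
  (L / (2 * (a / 2) ^+ n * n%:R / a) * (normc W.[b] / `|complex.Im b|)))).
  rewrite big_seq [leRHS]big_seq; apply: ler_sum => m; rewrite mem_iota add0n => mn.
  have W't : W^`().[t m] =
      ((chebyshev R (a / 2) n)^`().[cheb_node R a n m])%:C%C.
    by rewrite /W deriv_map horner_map.
  rewrite !normcM !normcV W't normc_real.
  have := deriv_chebyshev_ge R a n m a0 mn => le_d.
  apply: ler_pM; rewrite ?mulr_ge0 ?invr_ge0 ?normc_ge0 //.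
    apply: ler_pM; rewrite ?invr_ge0 ?normc_ge0 ?PL //.
    by rewrite lef_pV2 // posrE // (lt_le_trans c0).
  apply: ler_wpM2l; rewrite ?normc_ge0 //.
  have le_Im : `|complex.Im b| <= normc (b - t m).
    by apply: le_trans (normc_ge_Im _ _); case: (b) => u v /=; rewrite subr0.
  by rewrite lef_pV2 // posrE // (lt_le_trans Ib0).
rewrite big_const_seq count_predT size_iota iter_addr_0 WE -[_ *+ n]mulr_natr.
have -> : (2 / a) ^+ n = ((a / 2) ^+ n)^-1 by rewrite -exprVn invf_div.
rewrite le_eqVlt; apply/orP; left; apply/eqP.
field; rewrite expf_neq0 ?mulf_neq0 ?invr_neq0 // a_neq0 pnatr_eq0 -lt0n n0.
by rewrite gt_eqF.
Qed.


(** * Polynomials with equally spaced roots on a circle *)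

Lemma prod_ge0_le (R : realDomainType) (I : Type) (s : seq I) (f g : I -> R) :
  (forall i, 0 <= f i <= g i) ->
  \prod_(i <- s) f i <= \prod_(i <- s) g i.
Proof. by move=> fg; apply: ler_prod => i _; exact: fg. Qed.

(** For [r > 0] and [N > 0] the roots are equally spaced on the circle of radius [r] about [x]. The
    [N]-th root of the modulus thus approximates [max(r, |x - z|)], the exponential of the mean of
    [log |z - b|] for [b] on that circle. *)
Definition circle_poly (R : rcfType) (x r : R) (N : nat) : {poly R[i]} :=
  ('X - (x%:C%C)%:P) ^+ N - ((0 +i* (r ^+ N))%C)%:P.

Lemma circle_poly_split (R : rcfType) (x r : R) N : (0 < N)%N ->
  exists2 s : seq R[i], circle_poly R x r N = \prod_(b <- s) ('X - b%:P) &
    size s = N.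
Proof.
move=> N0; have [s] := closed_field_poly_normal (circle_poly R x r N).
have szX : size (('X - (x%:C%C)%:P) ^+ N : {poly R[i]}) = N.+1 by rewrite size_exp_XsubC.
have lt : (size (- ((0 +i* (r ^+ N)%R)%C)%:P : {poly R[i]})%R <
  size (('X - (x%:C%C)%:P) ^+ N : {poly R[i]})%R)%N.
  by rewrite szX size_polyN (leq_ltn_trans (size_polyC_leq1 _)) // ltnS.
have mon : lead_coef (circle_poly R x r N) = 1.
  rewrite lead_coefDl //; apply/monicP.
  by rewrite monic_exp ?monicXsubC.
rewrite mon scale1r => sE; exists s => //.
have : size (circle_poly R x r N) = N.+1 by rewrite size_polyDl.
by rewrite sE size_prod_XsubC => -[].
Qed.

Lemma horner_circle_poly (R : rcfType) (x r : R) N z :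
  (circle_poly R x r N).[z] = (z - x%:C%C) ^+ N - (0 +i* (r ^+ N))%C.
Proof. by rewrite /circle_poly hornerD hornerN horner_exp hornerXsubC hornerC. Qed.

(** For real [z] the power [(z - x)^N] is real and cannot equal [i r^N]. *)
Lemma circle_poly_root_Im (R : rcfType) (x r : R) N z : 0 < r ->
  root (circle_poly R x r N) z -> complex.Im z != 0.
Proof.
move=> r0; rewrite /root horner_circle_poly subr_eq0; apply: contraTneq.
case: z => u v /= ->.
have -> : ((u +i* 0) - x%:C = (u - x)%:C)%C by simpc.
rewrite -rmorphXn /= eq_complex /= negb_and; apply/orP; right.
by rewrite lt_eqF // exprn_gt0.
Qed.

Lemma normc_circle_poly_le (R : rcfType) (x r t : R) N : 1 <= r ->
  normc (circle_poly R x r N).[(t%:C)%C] <= 2 * (r * Num.max 1 `|x - t|) ^+ N.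
Proof.
move=> r1; have r0 : 0 <= r by rewrite (le_trans ler01).
rewrite horner_circle_poly (le_trans (normcD_le _ _ _)) // normc_opp normcX.
rewrite -rmorphB normc_real distrC.
have -> : normc (0 +i* (r ^+ N))%C = r ^+ N.
  by rewrite /= expr0n /= add0r sqrtr_sqr ger0_norm ?exprn_ge0.
have m1 : 1 <= Num.max 1 `|x - t| by rewrite le_max lexx.
have mt : `|x - t| <= Num.max 1 `|x - t| by rewrite le_max lexx orbT.
have m0 := le_trans ler01 m1.
rewrite mulr_natl mulr2n; apply: lerD; apply: lerXn2r; rewrite ?nnegrE ?mulr_ge0 //.
  by rewrite (le_trans mt) // ler_peMl.
by rewrite ler_peMr.
Qed.

Lemma normc_circle_poly_ge (R : rcfType) (x r : R) z N : 0 < r ->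
  `|r ^+ N - normc (x%:C%C - z) ^+ N| <= normc (circle_poly R x r N).[z].
Proof.
move=> r0; rewrite horner_circle_poly (normcB _ _ z).
set u := normc _; set w := (z - _) ^+ N; set v := (0 +i* _)%C.
have uE : u ^+ N = normc w by rewrite /w normcX.
have vE : r ^+ N = normc v.
  by rewrite /= expr0n /= add0r sqrtr_sqr ger0_norm ?exprn_ge0 ?ltW.
have tri (y1 y2 : R[i]) : normc y1 - normc y2 <= normc (y1 - y2).
  by rewrite lerBlDr -[X in normc X <= _](subrK y2) normcD_le.
rewrite uE vE ler_norml lerNl opprB; apply/andP; split; first exact: tri.
by apply: le_trans (tri v w) _; rewrite normcB.
Qed.

(** * The bound on the roots *)

Lemma bernoulli_le (R : realDomainType) (y : R) n : -1 <= y ->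
  1 + n%:R * y <= (1 + y) ^+ n.
Proof.
move=> y1; elim: n => [|n IH]; first by rewrite mul0r addr0 expr0.
have y0 : 0 <= 1 + y by lra.
have := ler_wpM2l y0 IH; rewrite -exprS; apply: le_trans.
have : 0 <= n%:R * y ^+ 2 by rewrite mulr_ge0 ?sqr_ge0.
rewrite -natr1; nra.
Qed.

(** Replaces taking [n]-th roots: if [X > Y > 0], Bernoulli makes [(X / Y)^n] grow at least linearly
    and pass [D]. *)
Lemma ler_of_powers (R : archiRealFieldType) (X Y D : R) : 0 <= X -> 0 <= Y ->
  (forall n, (0 < n)%N -> X ^+ n <= D * Y ^+ n) -> X <= Y.
Proof.
move=> X0 Y0 XY; rewrite leNgt; apply/negP => ltYX.
have [Y_eq0|Y_neq0] := eqVneq Y 0.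
  by have := XY 1%N isT; rewrite !expr1 Y_eq0 mulr0 leNgt -Y_eq0 ltYX.
have Ypos : 0 < Y by rewrite lt_def Y_neq0.
pose u := X / Y - 1.
have u0 : 0 < u by rewrite subr_gt0 ltr_pdivlMr // mul1r.
have uD n : (0 < n)%N -> n%:R * u <= D.
  move=> n0; have : (1 + u) ^+ n <= D.
    by rewrite /u addrC subrK expr_div_n ler_pdivrMr ?exprn_gt0 ?XY.
  have : 1 + n%:R * u <= (1 + u) ^+ n by apply: bernoulli_le; lra.
  lra.
have D0 : 0 <= D by have := uD 1%N isT; rewrite mul1r; lra.
have := archi_boundP (divr_ge0 D0 (ltW u0)); rewrite ltr_pdivrMr //.
have [->|b0] := posnP (Num.bound (D / u)); first by rewrite mul0r ltNge D0.
by rewrite ltNge uD.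
Qed.

Lemma ler_of_scaled_powers (R : realFieldType) (X Y : R) n : 0 <= Y ->
  (forall r, 1 < r -> X <= Y * r ^+ n) -> X <= Y.
Proof.
move=> Y0 XY; rewrite leNgt; apply/negP => ltYX.
have X0 : 0 < X by exact: le_lt_trans ltYX.
(* The radius used is [r = 1 / (1 - e)]. With this [e], Bernoulli gives
   [X (1 - e)^n >= X - n X e = Y + X e > Y]. *)
pose e := (X - Y) / (n.+1%:R * X).
have nX0 : 0 < n.+1%:R * X by rewrite mulr_gt0.
have e0 : 0 < e by rewrite divr_gt0 // subr_gt0.
have eE : n.+1%:R * X * e = X - Y by rewrite /e mulrC divfK // gt_eqF.
have [n0|n_gt0] := posnP n.
  by have := XY 2; rewrite n0 expr0 mulr1 ltr1n leNgt ltYX => /(_ isT).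
have e1 : e < 1.
  rewrite ltr_pdivrMr // mul1r -natr1 mulrDl mul1r.
  by have : 0 < n%:R * X; [rewrite mulr_gt0 // ltr0n | lra].
have e1' : 0 < 1 - e by lra.
have XY' : X * (1 - e) ^+ n <= Y.
  rewrite -ler_pdivlMr ?exprn_gt0 // -exprVn XY // invf_gt1 //; lra.
have : 1 + n%:R * (- e) <= (1 - e) ^+ n by apply: bernoulli_le; lra.
move=> /(ler_wpM2l (ltW X0)) h.
have h' := le_trans h XY'.
by move: eE; rewrite -natr1 => eE; have := mulr_gt0 X0 e0; lra.
Qed.

(** Provides radii near 1 that differ from every [|x - z|], since the lower bound for [|B(z)|]
    degenerates when they coincide. An entry [u > 1] is avoided by staying below [(1 + u) / 2]. *)
Lemma avoid_seq (R : realFieldType) (s : seq R) (r : R) : 1 < r ->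
  exists2 r', 1 < r' <= r & r' \notin s.
Proof.
elim: s r => [|u s IH] r r1; first by exists r; rewrite ?r1 ?lexx.
have [u1|u1] := ltrP 1 u; last first.
  have [r' /andP[r'1 r'r] r's] := IH r r1; exists r'; first by rewrite r'1.
  by rewrite in_cons negb_or r's gt_eqF // (le_lt_trans u1).
have : 1 < Num.min r ((1 + u) / 2) by rewrite lt_min r1 /=; lra.
move=> /IH[r' /andP[r'1]]; rewrite le_min => /andP[r'r r'u] r's.
exists r'; first by rewrite r'1.
by rewrite in_cons negb_or r's lt_eqF //; lra.
Qed.

Lemma pow_gap (R : realFieldType) (u v : R) N : 0 <= u < v -> (0 < N)%N ->
  (1 - u / v) * v ^+ N <= v ^+ N - u ^+ N.
Proof.
move=> /andP[u0 uv] N0; have v0 := le_lt_trans u0 uv.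
rewrite mulrBl mul1r lerD2l lerN2 -ler_pdivrMr ?exprn_gt0 // -expr_div_n.
have uv1 : u / v <= 1 by rewrite ler_pdivrMr // mul1r ltW.
by rewrite -[leRHS]expr1 ler_wiXn2l // divr_ge0 // ltW.
Qed.

(** What matters is that [c] does not depend on [N]: it disappears when [N] tends to infinity. *)
Lemma pow_gap_max (R : realFieldType) (r u : R) : 0 < r -> 0 <= u -> r != u ->
  exists2 c, 0 < c & forall N, (0 < N)%N ->
    c * Num.max r u ^+ N <= `|r ^+ N - u ^+ N|.
Proof.
move=> r0 u0; rewrite neq_lt => /orP[ru|ur].
  exists (1 - r / u) => [|N N0].
    by rewrite subr_gt0 ltr_pdivrMr ?mul1r // (lt_trans r0).
  rewrite (max_r (ltW ru)) distrC (le_trans _ (ler_norm _)) //.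
  by apply: pow_gap => //; rewrite ltW.
exists (1 - u / r) => [|N N0].
  by rewrite subr_gt0 ltr_pdivrMr ?mul1r.
rewrite (max_l (ltW ur)) (le_trans _ (ler_norm _)) //.
by apply: pow_gap => //; rewrite u0.
Qed.

Lemma circle_poly_prod_ge (R : rcfType) (x r : R) (s : seq R[i]) : 0 < r ->
  r \notin [seq normc (x%:C%C - z) | z <- s] ->
  exists2 c, 0 < c & forall N, (0 < N)%N ->
    c * (\prod_(z <- s) Num.max r (normc (x%:C%C - z))) ^+ N
    <= \prod_(z <- s) normc (circle_poly R x r N).[z].
Proof.
move=> r0; elim: s => [_|z s IH].
  by exists 1 => // N _; rewrite !big_nil expr1n mulr1.
rewrite /= in_cons negb_or => /andP[rz /IH[c c0 cP]].
have [d d0 dP] := pow_gap_max _ _ _ r0 (normc_ge0 _ _) rz.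
exists (d * c) => [|N N0]; first by rewrite mulr_gt0.
rewrite !big_cons exprMn mulrACA; apply: ler_pM; last exact: cP.
- by rewrite mulr_ge0 ?ltW // exprn_gt0 // lt_max r0.
- rewrite mulr_ge0 ?ltW // exprn_gt0 // prodr_gt0 // => w _.
  by rewrite lt_max r0.
- exact: le_trans (dP N N0) (normc_circle_poly_ge _ _ _ _ _ r0).
Qed.

(** Here [N] is fixed and the power [K] of [p] tends to infinity. The hypothesis on [k] and [E]
    isolates the only information needed about the nodes. *)
Lemma circle_poly_prod_le (R : realType) (a x r L k E : R) (s : seq R[i]) N :
  0 < a -> 1 <= r -> 0 <= L -> 0 <= E -> (0 < N)%N ->
  let p := \prod_(z <- s) ('X - z%:P) in
  (forall y, `|y| <= a -> normc p.[(y%:C)%C] <= L) ->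
  (forall n, (0 < n)%N ->
    \prod_(m <- iota 0 n) Num.max 1 `|x - cheb_node R a n m| <= k * E ^+ n) ->
  \prod_(z <- s) normc (circle_poly R x r N).[z] <=
  2 ^+ size s * (L * (2 / a * r * E) ^+ size s) ^+ N.
Proof.
move=> a0 r1 L0 E0 N0 p pL xE.
have r0 : 0 < r by rewrite (lt_le_trans ltr01).
have a20 : 0 <= 2 / a by rewrite divr_ge0 // ltW.
have r0' := ltW r0; have a0' := ltW a0.
set q := 2 / a * r * E; have q0 : 0 <= q by rewrite mulr_ge0 // mulr_ge0.
have k0 : 0 <= k * E.
  rewrite -[E]expr1; apply: (le_trans _ (xE 1%N isT)); apply: prodr_ge0 => m _.
  by rewrite le_max ler01.
have [sB BE sN] := circle_poly_split R x r N N0.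
have swap (t : R[i]) : normc (circle_poly R x r N).[t] = \prod_(b <- sB) normc (b - t).
  rewrite BE horner_prod normc_prod; apply: eq_bigr => b _.
  by rewrite hornerXsubC normcB.
have sBI b : b \in sB -> complex.Im b != 0.
  move=> bs; apply: (circle_poly_root_Im R x r N) => //.
  by rewrite BE root_prod_XsubC.
pose w (b : R[i]) := a / (2 * `|complex.Im b|).
pose D := \prod_(b <- sB) w b.
have D0 : 0 <= D by rewrite prodr_ge0 // => b _; rewrite divr_ge0 ?mulr_ge0 //.
(* [D] collects the constants depending on [Im b]. The other factors come from [k] and from the one
   node beyond the degree: interpolating [p^K] takes [M = size s * K + 1] nodes. *)
apply: (ler_of_powers _ _ _ (D * 2 ^+ 1 * (k * E) ^+ N * (2 / a * r) ^+ N)).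
- by rewrite prodr_ge0 // => z _; rewrite normc_ge0.
- by rewrite mulr_ge0 ?exprn_ge0 // mulr_ge0 // exprn_ge0.
move=> K K0.
have [M ME M0] : exists2 M, M = (size s * K).+1 & (0 < M)%N by exists (size s * K).+1.
have sP : size (p ^+ K) = M.
  have pK : (0 < size (p ^+ K))%N.
    by rewrite size_poly_gt0 expf_neq0 // monic_neq0 // monic_prod_XsubC.
  by rewrite ME -(prednK pK) size_exp (size_prod_XsubC s id).
have step b : b \in sB -> normc p.[b] ^+ K <=
    L ^+ K * w b * (2 / a) ^+ M *
    \prod_(m <- iota 0 M) normc (b - (cheb_node R a M m)%:C%C).
  move=> bs; rewrite -normcX -horner_exp.
  apply: normc_horner_le => //; rewrite ?sP ?sBI // => m mM.
  rewrite horner_exp normcX; apply: lerXn2r; rewrite ?nnegrE ?normc_ge0 //.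
  by rewrite pL // norm_cheb_node.
(* Both sides are the modulus of the resultant of [p] and [B]. *)
have -> : \prod_(z <- s) normc (circle_poly R x r N).[z] =
    \prod_(b <- sB) normc p.[b].
  rewrite (eq_bigr _ (fun z _ => swap z)) exchange_big; apply: eq_bigr => b _ /=.
  rewrite horner_prod normc_prod; apply: eq_bigr => z _.
  by rewrite hornerXsubC.
clearbody w; rewrite -prodrXl.
apply: (@le_trans _ _ (\prod_(b <- sB) (L ^+ K * w b *
    (2 / a) ^+ M * \prod_(m <- iota 0 M) normc (b - (cheb_node R a M m)%:C%C)))).
  rewrite big_seq [leRHS]big_seq; apply: ler_prod => b bs.
  by rewrite exprn_ge0 ?normc_ge0 // step.
rewrite !big_split /= exchange_big /= -/D !big_const_seq !count_predT !sN.
(* The second exchange: the product over the roots [b] of the distances to a node is the modulus of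
   [B] at that node. *)
rewrite !iter_mulr_1 (eq_bigr _ (fun m _ => esym (swap _))).
have nodes : \prod_(m <- iota 0 M) normc (circle_poly R x r N).[(cheb_node R a M m)%:C%C]
    <= 2 ^+ M * (r ^+ M * (k * E ^+ M)) ^+ N.
  apply: (@le_trans _ _ (\prod_(m <- iota 0 M)
      (2 * (r * Num.max 1 `|x - cheb_node R a M m|) ^+ N))).
    by apply: prod_ge0_le => m; rewrite normc_ge0 normc_circle_poly_le.
  rewrite big_split /= prodrXl big_split /= !big_const_seq !count_predT size_iota.
  rewrite !iter_mulr_1 ler_wpM2l ?exprn_ge0 //; apply: lerXn2r.
  - rewrite nnegrE mulr_ge0 ?exprn_ge0 //; apply: prodr_ge0 => m _.
    by rewrite le_max ler01.
  - rewrite nnegrE mulr_ge0 ?exprn_ge0 //; apply: (le_trans _ (xE M M0)).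
    apply: prodr_ge0 => m _.
    by rewrite le_max ler01.
  - by rewrite ler_wpM2l ?exprn_ge0 // xE.
apply: (le_trans (ler_wpM2l _ nodes)).
  by do ?[exact: a20 | exact: L0 | exact: D0 | apply: mulr_ge0 | apply: exprn_ge0].
rewrite le_eqVlt; apply/orP; left; apply/eqP.
rewrite ME /q !(exprS, exprMn) -!exprM !(mulnC K) -!(mulnC N).
rewrite !mulnA.
ring.
Qed.

(** [N] tends to infinity with [r] fixed; then [r] decreases to 1 through radii different from all
    [|x - z|]. *)
Lemma prod_max_le (R : realType) (a x L k E : R) (s : seq R[i]) :
  0 < a -> 0 <= L -> 0 <= E ->
  let p := \prod_(z <- s) ('X - z%:P) in
  (forall y, `|y| <= a -> normc p.[(y%:C)%C] <= L) ->
  (forall n, (0 < n)%N ->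
    \prod_(m <- iota 0 n) Num.max 1 `|x - cheb_node R a n m| <= k * E ^+ n) ->
  \prod_(z <- s) Num.max 1 (normc (x%:C%C - z)) <= L * (2 / a * E) ^+ size s.
Proof.
move=> a0 L0 E0 p pL xE.
have a20 : 0 <= 2 / a by rewrite divr_ge0 // ltW.
apply: (ler_of_scaled_powers _ _ _ (size s)).
  by rewrite mulr_ge0 // exprn_ge0 // mulr_ge0.
move=> r0 /(avoid_seq _ [seq normc (x%:C%C - z) | z <- s])[r /andP[r1 rr0] rs].
have rp : 0 < r by rewrite (lt_trans ltr01).
apply: (@le_trans _ _ (\prod_(z <- s) Num.max r (normc (x%:C%C - z)))).
  apply: prod_ge0_le => z; rewrite le_max ler01 /=.
  by rewrite ge_max !le_max lexx orbT (ltW r1).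
apply: (@le_trans _ _ (L * (2 / a * r * E) ^+ size s)); last first.
  rewrite -[leRHS]mulrA ler_wpM2l // -exprMn; apply: lerXn2r.
  - by rewrite nnegrE mulr_ge0 // mulr_ge0 // ltW.
  - by rewrite nnegrE !(mulr_ge0 a20, mulr_ge0) // (le_trans (ltW rp)).
  - by rewrite [2 / a * r * E]mulrAC ler_wpM2l // mulr_ge0.
have [c c0 cP] := circle_poly_prod_ge _ _ _ _ rp rs.
apply: (ler_of_powers _ _ _ (2 ^+ size s / c)).
- by apply: prodr_ge0 => z _; rewrite le_max (ltW rp).
- by rewrite mulr_ge0 // exprn_ge0 // mulr_ge0 // mulr_ge0 // ltW.
move=> N N0; rewrite mulrAC ler_pdivlMr // mulrC.
apply: le_trans (cP N N0) _.
exact: (circle_poly_prod_le _ _ _ _ _ _ _ _ _ a0 (ltW r1) L0 E0 N0 pL xE).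
Qed.

(** * Means of log+ over the nodes *)

(** This is [log+]. The argument of [ln] is at least 1, so its default value never occurs and the
    function is 1-Lipschitz. *)
Definition logp (R : realType) (u : R) : R := ln (Num.max 1 u).

Lemma max1_gt0 (R : realType) (u : R) : 0 < Num.max 1 u.
Proof. by rewrite lt_max ltr01. Qed.

Lemma expR_logp (R : realType) (u : R) : expR (logp R u) = Num.max 1 u.
Proof. by rewrite lnK // posrE max1_gt0. Qed.

Lemma logp_le1 (R : realType) (u : R) : u <= 1 -> logp R u = 0.
Proof. by move=> u1; rewrite /logp max_l // ln1. Qed.

Lemma logp_ge1 (R : realType) (u : R) : 1 <= u -> logp R u = ln u.
Proof. by move=> u1; rewrite /logp max_r. Qed.

Lemma logp_lip (R : realType) (u v : R) : `|logp R u - logp R v| <= `|u - v|.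
Proof.
wlog uv : u v / u <= v.
  by move=> H; case: (leP u v) => [|/ltW] /H //; rewrite distrC (distrC v).
have m : Num.max 1 u <= Num.max 1 v by rewrite ge_max !le_max lexx uv orbT.
have u0 := max1_gt0 R u; have v0 := max1_gt0 R v.
rewrite distrC (distrC u) ger0_norm ?subr_ge0 ?ler_ln // ger0_norm ?subr_ge0 //.
rewrite -ln_div ?posrE // -[_ / _](subrK 1) addrC.
have q1 : 1 <= Num.max 1 v / Num.max 1 u by rewrite ler_pdivlMr // mul1r.
rewrite (le_trans (le_ln1Dx _)) //; first by rewrite (lt_le_trans (ltrN10 _)) ?subr_ge0.
rewrite lerBlDr ler_pdivrMr // mulrDl mul1r.
have [u1|u1] := leP u 1; have [v1|v1] := leP v 1; rewrite ?mulr1; nra.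
Qed.

Lemma logp_geometric_mean (R : realType) (u v w : R) :
  0 <= u -> 0 <= v -> w ^+ 2 = u * v ->
  logp R w *+ 2 <= logp R u + logp R v.
Proof.
move=> u0 v0 wuv; rewrite /logp -lnXn ?max1_gt0 // -lnM ?posrE ?max1_gt0 //.
rewrite ler_ln ?posrE ?exprn_gt0 ?mulr_gt0 ?max1_gt0 //.
have mu : 1 <= Num.max 1 u by rewrite le_max lexx.
have mv : 1 <= Num.max 1 v by rewrite le_max lexx.
have um : u <= Num.max 1 u by rewrite le_max lexx orbT.
have vm : v <= Num.max 1 v by rewrite le_max lexx orbT.
have [w1|w1] := leP w 1; first by rewrite expr1n; nra.
by rewrite wuv ler_pM.
Qed.

Lemma cos_lip (R : realType) (s t : R) : `|cos s - cos t| <= `|s - t|.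
Proof.
wlog st : s t / s <= t.
  by move=> H; case: (leP s t) => [|/ltW] /H //; rewrite distrC (distrC t).
have [c _ cE] := @MVT_segment R cos (fun x => - sin x) s t st
  (fun x _ => is_derive_cos x) (continuous_subspaceT (@continuous_cos R)).
by rewrite distrC cE (distrC s) normrM ler_piMl // normrN sin_max.
Qed.

(** Since [a + a cos t] is the distance from [- a] to [a cos t] when [a > 0], this is the integrand
    of [J (- a)] in the angle variable. *)
Definition logp_cos (R : realType) (a t : R) : R := logp R (a + a * cos t).

Lemma logp_cos_lip (R : realType) (a s t : R) : 0 < a ->
  `|logp_cos R a s - logp_cos R a t| <= a * `|s - t|.
Proof.
move=> a0; rewrite (le_trans (logp_lip _ _ _)) //.
rewrite opprD addrACA subrr add0r -mulrBr normrM gtr0_norm //.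
by rewrite ler_wpM2l ?cos_lip // ltW.
Qed.

Lemma cheb_angleE (R : realType) n m :
  cheb_angle R n m = (2 * m%:R + 1) * pi / (2 * n%:R).
Proof. by rewrite /cheb_angle -!mul2n -natr1 !natrM. Qed.

Lemma cheb_angleS (R : realType) n m : (0 < n)%N ->
  cheb_angle R n m.+1 = cheb_angle R n m + pi / n%:R.
Proof.
move=> n0; rewrite !cheb_angleE -(natr1 m).
by field; rewrite pnatr_eq0 -lt0n.
Qed.

(** Consecutive angles differ by [pi / n], so the shift permutes the [2n] angles cyclically modulo
    [2 pi]. *)
Lemma logp_cos_sum_shift (R : realType) (a t : R) n : (0 < n)%N ->
  \sum_(0 <= m < n.*2) logp_cos R a (t + pi / n%:R + cheb_angle R n m) =
  \sum_(0 <= m < n.*2) logp_cos R a (t + cheb_angle R n m).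
Proof.
move=> n0; pose G m := logp_cos R a (t + cheb_angle R n m).
transitivity (\sum_(0 <= m < n.*2) G m.+1).
  by apply: eq_bigr => m _; rewrite /G cheb_angleS // addrA addrAC.
have : \sum_(0 <= m < n.*2.+1) G m = \sum_(0 <= m < n.*2.+1) G m by [].
rewrite {1}big_nat_recl // big_nat_recr //.
have -> : G n.*2 = G 0%N.
  rewrite /G /logp_cos.
  suff -> : cheb_angle R n n.*2 = cheb_angle R n 0 + pi *+ 2.
    by rewrite addrA cosD2pi.
  rewrite !cheb_angleE -[n.*2]mul2n natrM -[pi *+ 2]mulr_natr.
  by field; rewrite pnatr_eq0 -lt0n.
by rewrite addrC => /(@addIr R (G 0%N)).
Qed.

(** Shifts by [pi / n] bring [t] into [[0, pi / n]]. There each of the [2n] terms changes by at most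
    [a pi / n], by the Lipschitz bound. *)
Lemma logp_cos_sum_le (R : realType) (a t : R) n : 0 < a -> (0 < n)%N ->
  0 <= t <= pi ->
  \sum_(0 <= m < n.*2) logp_cos R a (t + cheb_angle R n m) <=
  \sum_(0 <= m < n.*2) logp_cos R a (0 + cheb_angle R n m) + 2 * a * pi.
Proof.
move=> a0 n0; have n_neq0 : n%:R != 0 :> R by rewrite pnatr_eq0 -lt0n.
have npi : n%:R * (pi / n%:R) = pi :> R by rewrite mulrC divfK.
(* The upper bound [pi] on [t] becomes [k * (pi / n)], for induction on the number of shifts. *)
rewrite -{1}npi; move: {1}n => k.
elim: k t => [|k IH] t /andP[t0].
  rewrite mul0r => tk; have -> : t = 0 by apply/eqP; rewrite eq_le t0 tk.
  by rewrite lerDl !mulr_ge0 ?pi_ge0 // ltW.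
move=> tk.
have [le_t|lt_t] := leP t (pi / n%:R); last first.
  rewrite -(subrK (pi / n%:R) t) logp_cos_sum_shift // IH // subr_ge0 ltW //=.
  by rewrite lerBlDr -[X in _ + X]mul1r -mulrDl natr1.
rewrite -lerBlDl -sumrB.
apply: (@le_trans _ _ (\sum_(0 <= m < n.*2) (a * (pi / n%:R)))).
  apply: ler_sum => m _; apply: le_trans (ler_norm _) _.
  apply: le_trans (logp_cos_lip _ _ _ _ a0) _.
  by rewrite add0r addrK ger0_norm // ler_wpM2l // ltW.
rewrite sumr_const_nat subn0 -mul2n -[_ *+ (2 * n)]mulr_natr natrM le_eqVlt.
by apply/orP; left; apply/eqP; field.
Qed.

(** The angle of index [2n - 1 - m] is [2 pi] minus the angle of index [m]. *)
Lemma logp_cos_sum_fold (R : realType) (a t : R) n : (0 < n)%N ->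
  \sum_(0 <= m < n.*2) logp_cos R a (t + cheb_angle R n m) =
  \sum_(0 <= m < n)
    (logp_cos R a (t + cheb_angle R n m) + logp_cos R a (t - cheb_angle R n m)).
Proof.
move=> n0; rewrite (@big_cat_nat _ _ _ n) //=; last by rewrite -addnn leq_addr.
rewrite big_split /=; congr (_ + _).
rewrite -{1}[n]add0n big_addn -addnn addnK big_nat_rev /=.
apply: eq_big_nat => m /andP[_ mn]; rewrite /logp_cos.
suff -> : cheb_angle R n (0 + n - m.+1 + n) = pi *+ 2 - cheb_angle R n m.
  by rewrite addrA addrAC cosD2pi.
rewrite add0n !cheb_angleE natrD natrB // -(natr1 m) -[pi *+ 2]mulr_natr.
by field; rewrite pnatr_eq0 -lt0n.
Qed.

Lemma prod_max_nodes_le (R : realType) (a x I c : R) n : 0 < a -> `|x| <= a ->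
  (0 < n)%N ->
  `|\sum_(0 <= m < n) logp_cos R a (cheb_angle R n m) - n%:R * I| <= c ->
  \prod_(m <- iota 0 n) Num.max 1 `|x - cheb_node R a n m| <=
  expR (c + a * pi) * expR I ^+ n.
Proof.
move=> a0 xa n0 Ic.
have an0 : a != 0 by rewrite gt_eqF.
have xaP : -1 <= - x / a <= 1.
  by rewrite ler_pdivlMr // ler_pdivrMr // mulN1r mul1r -ler_norml normrN.
pose t := acos (- x / a).
have xE : x = - (a * cos t).
  by rewrite /t acosK ?in_itv //= mulrC divfK // opprK.
have t0pi : 0 <= t <= pi by rewrite /t acos_ge0 ?acos_lepi.
have -> : iota 0 n = index_iota 0 n by rewrite /index_iota subn0.
under eq_bigr do rewrite -expR_logp.
rewrite -expR_sum -expRM_natl -expRD ler_expR.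
have := logp_cos_sum_le _ _ _ _ a0 n0 t0pi.
rewrite !logp_cos_sum_fold //.
(* At [t = 0] the two folded summands coincide because cosine is even. The resulting factor 2 also
   halves the error [2 a pi]. *)
under [X in _ <= X + _ -> _]eq_bigr do
  rewrite add0r sub0r {2}/logp_cos cosN -/(logp_cos _ _ _) -mulr2n.
rewrite sumrMnl => le_sum.
have : (\sum_(0 <= m < n) logp R `|x - cheb_node R a n m|) *+ 2 <=
  \sum_(0 <= m < n)
   (logp_cos R a (t + cheb_angle R n m) + logp_cos R a (t - cheb_angle R n m)).
  have cosp y : 0 <= a + a * cos y.
    by have := ler_wpM2l (ltW a0) (cos_geN1 y); rewrite mulrN1; lra.
  rewrite -sumrMnl; apply: ler_sum => m _.
  apply: logp_geometric_mean.
  - exact: cosp.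
  - exact: cosp.
  rewrite real_normK ?num_real // xE /cheb_node cosB cosD.
  have := cos2Dsin2 t; have := cos2Dsin2 (cheb_angle R n m).
  set u := cos t; set v := sin t; set u' := cos _; set v' := sin _.
  move=> E1 E2.
  rewrite [RHS](_ : _ = a ^+ 2 * ((1 + u * u') ^+ 2 - v ^+ 2 * v' ^+ 2)); last by ring.
  rewrite (_ : v ^+ 2 = 1 - u ^+ 2); last by rewrite -E2 addrC addKr.
  rewrite (_ : v' ^+ 2 = 1 - u' ^+ 2); last by rewrite -E1 addrC addKr.
  by ring.
move: Ic; rewrite ler_norml => /andP[_ Ic].
move=> /le_trans /(_ le_sum) {le_sum}; rewrite !mulr2n => le_sum.
lra.
Qed.

(** * The arcsine integral *)

Lemma continuous_logp_cos (R : realType) (a : R) : 0 < a ->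
  continuous (logp_cos R a).
Proof.
move=> a0 t; apply/cvgrPdist_lt => e e0; near=> s.
rewrite (le_lt_trans (logp_cos_lip _ _ _ _ a0)) // -ltr_pdivlMl // mulrC.
near: s; apply: cvgr_dist_lt; first exact: cvg_id.
by rewrite divr_gt0.
Unshelve. all: by end_near. Qed.

Lemma logp_cos_antiderivative (R : realType) (a : R) : 0 < a ->
  exists F : R -> R, forall t, 0 <= t <= pi -> is_derive t 1 F (logp_cos R a t).
Proof.
move=> a0; pose f := logp_cos R a.
(* Starting at [-1], and working up to [pi + 1], makes 0 and [pi] interior points, so the derivative
   is two-sided there. *)
pose F x := (\int[lebesgue_measure]_(t in [set` `[(-1 : R), x]]) f t)%R.
exists F => t /andP[t0 tpi].
have fi : (@lebesgue_measure R).-integrable `[-1, pi + 1] (EFin \o f).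
  apply: continuous_compact_integrable; first exact: segment_compact.
  exact/continuous_subspaceT/continuous_logp_cos.
have tpi1 : t < pi + 1 by lra.
have t1 : -1 < t by lra.
have [dF F'] := continuous_FTC1_closed tpi1 fi t1 (continuous_logp_cos R a a0 t).
by rewrite -[logp_cos R a t]F' derive1E; apply: DeriveDef.
Qed.

Lemma is_derive_continuous (R : realType) (f : R -> R) (x d : R) :
  is_derive x 1 f d -> {for x, continuous f}.
Proof.
by move=> fd; apply: differentiable_continuous; apply/derivable1_diffP.
Qed.

(** On each subinterval the mean of the integrand is its value at some [xi], within [pi / n] of the
    midpoint. The Lipschitz errors [a pi / n] add up to a bound independent of [n]. *)
Lemma logp_cos_riemann (R : realType) (a : R) (F : R -> R) n : 0 < a ->
  (forall t, 0 <= t <= pi -> is_derive t 1 F (logp_cos R a t)) -> (0 < n)%N ->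
  `|\sum_(0 <= m < n) logp_cos R a (cheb_angle R n m) -
    n%:R * ((F pi - F 0) / pi)| <= a * pi.
Proof.
move=> a0 dF n0; have n_gt0 : 0 < n%:R :> R by rewrite ltr0n.
have pi0 := pi_gt0 R.
pose d : R := pi / n%:R; have d0 : 0 < d by rewrite divr_gt0.
pose G m := F (m%:R * d).
have -> : F pi - F 0 = \sum_(0 <= m < n) (G m.+1 - G m).
  by rewrite telescope_sumr // /G mul0r /d mulrC divfK // gt_eqF.
rewrite mulr_suml mulr_sumr -sumrB (le_trans (ler_norm_sum _ _ _)) //.
apply: (@le_trans _ _ (\sum_(0 <= m < n) (a * d))); last first.
  rewrite sumr_const_nat subn0 -[_ *+ n]mulr_natr -mulrA /d divfK ?gt_eqF //.
rewrite big_nat [leRHS]big_nat; apply: ler_sum => m /andP[_ mn].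
have md : 0 <= m%:R * d by rewrite mulr_ge0 // ltW.
have mdS : m.+1%:R * d <= pi.
  by rewrite /d mulrCA ger_pMr // ler_pdivrMr // mul1r ler_nat.
have le_mS : m%:R * d <= m.+1%:R * d by rewrite ler_wpM2r ?ler_nat // ltW.
have dF' t : t \in `[m%:R * d, m.+1%:R * d] -> is_derive t 1 F (logp_cos R a t).
  rewrite in_itv /= => /andP[t1 t2]; apply: dF.
  by rewrite (le_trans md) // (le_trans t2).
have dFoo t : t \in `]m%:R * d, m.+1%:R * d[ -> is_derive t 1 F (logp_cos R a t).
  by rewrite in_itv /= => /andP[t1 t2]; apply: dF'; rewrite in_itv /= !ltW.
have cF : {within `[m%:R * d, m.+1%:R * d], continuous F}.
  apply/continuous_in_subspaceT => t; rewrite inE /= => /dF'.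
  exact: is_derive_continuous.
have [xi xim GE] := MVT_segment le_mS dFoo cF.
have -> : n%:R * ((G m.+1 - G m) / pi) = logp_cos R a xi.
  have cancel (p q k g : R) : p != 0 -> q != 0 ->
      q * (g * ((k + 1) * (p / q) - k * (p / q)) / p) = g.
    by move=> p0 q0; field; rewrite p0.
  by rewrite /G GE -natr1 /d cancel // gt_eqF.
apply: le_trans (logp_cos_lip _ _ _ _ a0) _; rewrite ler_pM2l //.
move: xim; rewrite in_itv /= => /andP[x1 x2].
have aE : cheb_angle R n m = m%:R * d + d / 2.
  by rewrite cheb_angleE /d; field; rewrite gt_eqF.
by rewrite aE; move: x1 x2; rewrite -natr1 mulrDl mul1r ler_norml; lra.
Qed.

(** The logarithm is weighted by the arcsine density of [[- a, a]], the image of the uniform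
    probability on [[0, pi]] under [a cos]. *)
Definition arcsine_log (R : realType) (a t : R) : R :=
  ln (t + a) / (pi * Num.sqrt (a ^+ 2 - t ^+ 2)).

(** This is the substitution [t = a cos s]; [1 <= t + a] turns [log+] into [ln]. *)
Lemma is_derive_comp_acos (R : realType) (a t : R) (F : R -> R) :
  0 < a -> - a < t < a -> 1 <= t + a ->
  is_derive (acos (t / a)) 1 F (logp_cos R a (acos (t / a))) ->
  is_derive t 1 (fun s => - (F (acos (s / a)) / pi)) (arcsine_log R a t).
Proof.
move=> a0 /andP[t1 t2] ta dF.
have u : -1 < t / a < 1 by rewrite ltr_pdivlMr // ltr_pdivrMr // mulN1r mul1r t1.
have did : is_derive t 1 (fun s : R => s / a) a^-1.
  rewrite (_ : (fun s : R => s / a) = a^-1 \*: id); last first.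
    by apply/funext => s /=; rewrite /GRing.scale /= mulrC.
  rewrite -[X in is_derive _ _ _ X]mulr1; exact: is_deriveZ.
have dacos := @is_derive1_comp R (@acos R) (fun s => s / a) t _ _ (is_derive1_acos u) did.
have dFa := @is_derive1_comp R F (@acos R \o (fun s => s / a)) t _ _ dF dacos.
have := is_deriveZ (- pi^-1) dFa.
rewrite (_ : - pi^-1 \*: _ = fun s => - (F (acos (s / a)) / pi)); last first.
  by apply/funext => s /=; rewrite /GRing.scale /= mulNr mulrC.
move=> /is_derive_eq; apply.
rewrite /logp_cos acosK; last by rewrite in_itv /=; move: u => /andP[/ltW -> /ltW ->].
rewrite (_ : a + a * (t / a) = t + a); last first.
  by rewrite mulrC divfK ?gt_eqF // addrC.
rewrite logp_ge1 // /arcsine_log.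
have -> : Num.sqrt (a ^+ 2 - t ^+ 2) = a * Num.sqrt (1 - (t / a) ^+ 2).
  rewrite -[X in X * _]ger0_norm ?ltW // -sqrtr_sqr -sqrtrM ?sqr_ge0 //.
  by congr Num.sqrt; field; rewrite gt_eqF.
have s0 : Num.sqrt (1 - (t / a) ^+ 2) != 0.
  by rewrite gt_eqF // sqrtr_gt0; move: u => /andP[u1 u2]; nra.
have cancel (p q w l : R) : p != 0 -> q != 0 -> w != 0 ->
    (- p^-1) *: (l * (- w^-1 * q^-1)) = l / (p * (q * w)).
  by move=> p0 q0 w0; rewrite -[LHS]/(- p^-1 * (l * (- w^-1 * q^-1))); field; rewrite w0 q0.
by apply: cancel => //; rewrite gt_eqF // pi_gt0.
Qed.

Lemma continuous_arcsine_log (R : realType) (a t : R) :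
  - a < t < a -> {for t, continuous (arcsine_log R a)}.
Proof.
move=> /andP[t1 t2]; have q0 : 0 < a ^+ 2 - t ^+ 2 by nra.
apply: continuousM.
  apply: (@continuous_comp _ _ _ (fun s => s + a) (@ln R)).
    by apply: continuousD; [exact: cvg_id | exact: cst_continuous].
  by apply: continuous_ln; lra.
apply: continuousV.
  by rewrite mulf_neq0 // gt_eqF ?pi_gt0 // sqrtr_gt0.
apply: continuousM; first exact: cst_continuous.
apply: (@continuous_comp _ _ _ (fun s : R => a ^+ 2 - s ^+ 2) (@Num.sqrt R)).
  apply: continuousB; first exact: cst_continuous.
  exact: exprn_continuous.
exact: sqrt_continuous.
Qed.

(** Stopping at [a cos e < a] avoids the singularity of the density, and [1 - a > - a], so the
    fundamental theorem applies on a closed segment. *)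
Lemma arcsine_log_integral_segment (R : realType) (a e : R) (F : R -> R) :
  1 / 2 < a ->
  (forall t, 0 <= t <= pi -> is_derive t 1 F (logp_cos R a t)) ->
  0 < e < acos ((1 - a) / a) ->
  (\int[lebesgue_measure]_(t in `[(1 - a)%R, (a * cos e)%R]) (arcsine_log R a t)%:E =
   ((F (acos ((1 - a) / a)) - F e) / pi)%:E)%E.
Proof.
move=> a12 dF /andP[e0 e1]; have a0 : 0 < a by lra.
have ua : -1 <= (1 - a) / a <= 1.
  by rewrite ler_pdivlMr // ler_pdivrMr //; apply/andP; split; lra.
have epi : e < pi by rewrite (lt_le_trans e1) // acos_lepi.
have e_itv : e \in `[0, pi] by rewrite in_itv /= !ltW.
have lt_ends : 1 - a < a * cos e.
  rewrite -ltr_pdivrMl // mulrC -[ltLHS]acosK ?in_itv //.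
  by rewrite ltr_cos // in_itv /= acos_ge0 ?acos_lepi.
have cos1 : cos e < 1.
  by rewrite -cos0 ltr_cos // in_itv /= lexx pi_ge0.
have acos_e1 : a * cos e < a by rewrite gtr_pMr.
pose G s := - (F (acos (s / a)) / pi).
have dG s : 1 - a <= s <= a * cos e -> is_derive s 1 G (arcsine_log R a s).
  move=> /andP[s1 s2]; have sa : s < a by exact: le_lt_trans acos_e1.
  apply: is_derive_comp_acos => //; rewrite ?sa ?andbT; [lra|lra|].
  have us : -1 <= s / a <= 1.
    by rewrite ler_pdivlMr // ler_pdivrMr //; apply/andP; split; lra.
  by apply: dF; rewrite acos_ge0 ?acos_lepi.
have cG s : 1 - a <= s <= a * cos e -> {for s, continuous G}.
  by move=> /dG; exact: is_derive_continuous.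
rewrite (@continuous_FTC2 R _ G).
- rewrite -EFinB /G.
  have -> : a * cos e / a = cos e by rewrite mulrC mulKf // gt_eqF.
  by rewrite cosK // opprK addrC -mulrBl.
- exact: lt_ends.
- apply/continuous_in_subspaceT => s; rewrite inE /= in_itv /= => /andP[s1 s2].
  apply: continuous_arcsine_log; apply/andP; split; first lra.
  exact: le_lt_trans acos_e1.
- split.
  + move=> s; rewrite in_itv /= => /andP[s1 s2].
    by apply: @ex_derive _ _ _ _ _ _ _ (dG s _); rewrite !ltW.
  + by apply: cvg_at_right_filter; apply: cG; rewrite lexx ltW.
  + by apply: cvg_at_left_filter; apply: cG; rewrite lexx ltW.
- move=> s; rewrite in_itv /= => /andP[s1 s2]; rewrite derive1E.
  by apply: derive_val; apply: dG; rewrite !ltW.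
Qed.

Lemma cos_le_mono (R : realType) (s t : R) : 0 <= s <= pi -> 0 <= t <= pi ->
  (cos s <= cos t) = (t <= s).
Proof. by move=> s0 t0; rewrite !leNgt ltr_cos. Qed.

(** Monotone convergence along [[1 - a, a cos (e k)]] reaches the singular endpoint, as the
    integrand is nonnegative where [t + a >= 1]. The rest of [[0, pi]] contributes nothing, because
    [log+] vanishes there. *)
Lemma arcsine_log_integral (R : realType) (a : R) (F : R -> R) :
  1 / 2 < a ->
  (forall t, 0 <= t <= pi -> is_derive t 1 F (logp_cos R a t)) ->
  \int[lebesgue_measure]_(t in `[1 - a, a]) arcsine_log R a t =
  (F pi - F 0) / pi.
Proof.
move=> a12 dF; have a0 : 0 < a by lra.
have ua : -1 <= (1 - a) / a < 1.
  by rewrite ler_pdivlMr // ltr_pdivrMr //; apply/andP; split; lra.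
have ua' : -1 <= (1 - a) / a <= 1.
  by move: ua => /andP[-> /ltW ->].
pose al := acos ((1 - a) / a).
have al0 : 0 < al by exact: acos_gt0.
have alpi : al <= pi by exact: acos_lepi.
pose e k : R := al / k.+2%:R.
have e0 k : 0 < e k by rewrite divr_gt0.
have e1 k : e k < al by rewrite gtr_pMr // invf_lt1 // ltr1n.
have e_pi k : 0 <= e k <= pi.
  by rewrite ltW //= (le_trans (ltW (e1 k))).
have e_itv k : e k \in `[0, pi] by rewrite in_itv /= e_pi.
pose S k := [set` `[1 - a, a * cos (e k)]].
have e_dec i j : (i <= j)%N -> e j <= e i.
  by move=> ij; rewrite ler_pM2l // lef_pV2 ?posrE // ler_nat !ltnS.
have cos_e k : a * cos (e k) < a.
  rewrite gtr_pMr // -[ltRHS]cos0 ltr_cos // in_itv /= lexx; exact: pi_ge0.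
have cF0 : {for 0, continuous F}.
  by apply: is_derive_continuous; apply: dF; rewrite lexx pi_ge0.
have e_cvg : e k @[k --> \oo] --> (0 : R).
  rewrite -[X in _ --> X](mulr0 al); apply: cvgM; first exact: cvg_cst.
  by have := @cvg_harmonic R; rewrite -(@cvg_shiftS _ (@harmonic R)); apply.
have inS k t : S k t -> 1 - a <= t < a.
  by rewrite /S /= in_itv /= => /andP[-> /le_lt_trans ->].
have US : \bigcup_k S k = [set` `[1 - a, a[].
  apply/seteqP; split => t /=; first by move=> [k _ /inS]; rewrite in_itv.
  rewrite in_itv /= => /andP[t1 t2].
  have q0 : 0 < (a - t) / a by rewrite divr_gt0 // subr_gt0.
  have [k _ ek] : \forall k \near \oo, e k < (a - t) / a.
    by apply: (cvgr_lt 0).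
  exists k => //; rewrite /S /= in_itv /= t1 /=.
  (* The Lipschitz bound gives [a - a cos (e k) <= a e k < a - t]. *)
  have := cos_lip R 0 (e k); rewrite cos0 sub0r normrN (gtr0_norm (e0 k)).
  move=> /(le_trans (ler_norm _)) h.
  have := le_lt_trans h (ek k (leqnn k)); rewrite ltr_pdivlMr //; lra.
have mS k : measurable_fun (S k) (arcsine_log R a).
  suff cS : {within S k, continuous (arcsine_log R a)}.
    by apply: subspace_continuous_measurable_fun cS; exact: measurable_itv.
  apply/continuous_in_subspaceT => t; rewrite inE => /inS /andP[t1 t2].
  by apply: continuous_arcsine_log; apply/andP; split; lra.
have cvg_int : (\int[lebesgue_measure]_(t in S k) (arcsine_log R a t)%:E)%E
    @[k --> \oo] -->
    (\int[lebesgue_measure]_(t in `[(1 - a)%R, a[) (arcsine_log R a t)%:E)%E.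
  rewrite -US; apply: ge0_nondecreasing_set_cvg_integral.
  - move=> i j ij; apply/subsetPset => t; rewrite /S /= !in_itv /= => /andP[-> h].
    by rewrite (le_trans h) // ler_pM2l // cos_le_mono ?e_pi // e_dec.
  - by move=> k; exact: measurable_itv.
  - by move=> k; apply/measurable_EFinP; exact: mS.
  - move=> k t /inS /andP[t1 t2]; rewrite /= lee_fin divr_ge0 //.
      by rewrite ln_ge0 //; lra.
    by rewrite mulr_ge0 ?pi_ge0 ?sqrtr_ge0.
have intE : (\int[lebesgue_measure]_(t in `[(1 - a)%R, a[) (arcsine_log R a t)%:E =
   ((F al - F 0) / pi)%:E)%E.
  have cvg1 : (\int[lebesgue_measure]_(t in S k) (arcsine_log R a t)%:E)%E
      @[k --> \oo] --> ((F al - F 0) / pi)%:E.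
    under eq_fun do rewrite (arcsine_log_integral_segment R a _ F) ?e0 ?e1 //.
    apply: cvg_EFin; first exact: nearW.
    apply: cvgMl; apply: cvgB; first exact: cvg_cst.
    exact: (cvg_comp _ _ e_cvg cF0).
  rewrite -(cvg_lim _ cvg1) //; apply/esym/cvg_lim => //; exact: cvg_int.
(* Beyond [al] one has [a + a cos c <= 1], so [F] has derivative 0 there. *)
have -> : F pi = F al.
  have alI t : al <= t -> t <= pi -> is_derive t 1 F (logp_cos R a t).
    by move=> t1 t2; apply: dF; rewrite t2 (le_trans (ltW al0)).
  have [||c] := @MVT_segment R F (logp_cos R a) al pi alpi.
  - by move=> t; rewrite in_itv /= => /andP[t1 t2]; apply: alI; rewrite ltW.
  - apply/continuous_in_subspaceT => t; rewrite inE /= in_itv /= => /andP[t1 t2].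
    exact: is_derive_continuous (alI t t1 t2).
  rewrite in_itv /= => /andP[c1 c2] /eqP; rewrite /logp_cos logp_le1 ?mul0r.
    by rewrite subr_eq0 => /eqP.
  have : cos c <= (1 - a) / a.
    rewrite -[leRHS]acosK ?in_itv // cos_le_mono ?(ltW al0) //.
    by rewrite (le_trans (ltW al0)).
  by rewrite ler_pdivlMr //; lra.
rewrite /Rintegral -integral_itv_bndo_bndc ?intE //.
rewrite -US; apply/measurable_fun_bigcup => k; first exact: measurable_itv.
by apply/measurable_EFinP; exact: mS.
Qed.

(** * The smallest constant *)

Lemma poly_norm_ge (R : realType) (a x : R) (p : {poly R[i]}) : `|x| <= a ->
  normc p.[(x%:C)%C] <= poly_norm (real_segment (- a) a) p.
Proof.
move=> xa; apply: sup_ubound; last first.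
  by exists (x%:C)%C => //; exists x => //=; rewrite in_itv /= -ler_norml.
(* The set of values must be bounded above for [sup] to be an upper bound of it; the triangle
   inequality on the coefficients supplies this. *)
exists (\sum_(i < size p) normc p`_i * a ^+ i) => _ [_ [y ya <-] <-].
rewrite /= in_itv /= -ler_norml in ya.
rewrite -[leLHS]/(normc p.[(y%:C)%C]) horner_coef.
apply: le_trans (normc_sum_le _ _ _ _) _; apply: ler_sum => i _.
rewrite normcM normcX normc_real ler_wpM2l ?normc_ge0 //.
by apply: lerXn2r; rewrite ?nnegrE // (le_trans _ ya).
Qed.

Lemma poly_norm_le (R : realType) (a L : R) (p : {poly R[i]}) : 0 <= a ->
  (forall x, `|x| <= a -> normc p.[(x%:C)%C] <= L) ->
  poly_norm (real_segment (- a) a) p <= L.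
Proof.
move=> a0 pL; apply: ge_sup.
  by exists (normc p.[(0%:C)%C]); exists (0%:C)%C => //; exists 0 => //=;
    rewrite in_itv /= oppr_le0 a0.
move=> _ [_ [y ya <-] <-]; apply: pL.
by rewrite /= in_itv /= -ler_norml in ya.
Qed.

Lemma monic_splits (R : rcfType) (p : {poly R[i]}) : p \is monic ->
  exists s : seq R[i], p = \prod_(z <- s) ('X - z%:P).
Proof.
move=> /monicP p1; have [s sE] := closed_field_poly_normal p.
by exists s; rewrite {1}sE p1 scale1r.
Qed.

(** Each [|x - z|] over the roots of [q] is at most [max(1, |x - z|)], and the roots of the cofactor
    add factors at least 1, so the bound on all roots of [p] applies. *)
Lemma factor_constants_segment (R : realType) (a I c : R) : 0 < a ->
  (forall n, (0 < n)%N ->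
    `|\sum_(0 <= m < n) logp_cos R a (cheb_angle R n m) - n%:R * I| <= c) ->
  factor_constants (real_segment (- a) a) (2 / a * expR I).
Proof.
move=> a0 Ic; split; first by rewrite mulr_gt0 ?expR_gt0 // divr_gt0.
move=> p q pmon [qmon [r [rmon pE]]].
have [sq qE] := monic_splits _ _ qmon; have [sr rE] := monic_splits _ _ rmon.
have pE' : p = \prod_(z <- sq ++ sr) ('X - z%:P) by rewrite big_cat /= -qE -rE.
apply: poly_norm_le => [|x xa]; first exact: ltW.
have normE : normc q.[(x%:C)%C] = \prod_(z <- sq) normc (x%:C%C - z).
  rewrite qE horner_prod normc_prod; apply: eq_bigr => z _.
  by rewrite hornerXsubC.
rewrite normE.
apply: (@le_trans _ _ (\prod_(z <- sq ++ sr) Num.max 1 (normc (x%:C%C - z)))).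
  rewrite big_cat /=.
  rewrite -[leLHS]mulr1; apply: ler_pM; rewrite ?ler01 //.
  - by apply: prodr_ge0 => z _; exact: normc_ge0.
  - by apply: prod_ge0_le => z; rewrite normc_ge0 le_max lexx orbT.
  - elim: sr {rE pE'} => [|z s IH]; first by rewrite big_nil.
    by rewrite big_cons -[leLHS]mulr1 ler_pM // le_max lexx.
have -> : (size p).-1 = size (sq ++ sr) by rewrite pE' (size_prod_XsubC _ id).
rewrite mulrC.
apply: (prod_max_le R a x _ (expR (c + a * pi)) (expR I)) => //.
- by apply: le_trans (normc_ge0 _ _) (poly_norm_ge R a x p xa).
- by move=> y ya; rewrite -pE'; exact: poly_norm_ge.
- by move=> n n0; apply: prod_max_nodes_le => //; exact: Ic.
Qed.

Lemma chebyshev_poly_norm (R : realType) (a : R) n : 0 < a -> (0 < n)%N ->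
  poly_norm (real_segment (- a) a)
    (\prod_(m <- iota 0 n) ('X - ((cheb_node R a n m)%:C%C)%:P)) <=
  2 * (a / 2) ^+ n.
Proof.
move=> a0 n0; have a_neq0 : a != 0 by rewrite gt_eqF.
apply: poly_norm_le => [|x xa]; first exact: ltW.
have -> : \prod_(m <- iota 0 n) ('X - ((cheb_node R a n m)%:C%C)%:P) =
    map_poly (real_complex R) (chebyshev R (a / 2) n).
  rewrite chebyshev_prod // rmorph_prod; apply: eq_bigr => m _ /=.
  by rewrite rmorphB /= map_polyX map_polyC.
rewrite horner_map normc_real.
have xaP : -1 <= x / a <= 1.
  by rewrite ler_pdivlMr // ler_pdivrMr // mulN1r mul1r -ler_norml.
rewrite (_ : x = a * cos (acos (x / a))); last first.
  by rewrite acosK ?in_itv // mulrC divfK.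
have c0 : 0 <= 2 * (a / 2) ^+ n by rewrite mulr_ge0 // exprn_ge0 // divr_ge0 // ltW.
by rewrite horner_chebyshev normrM ger0_norm // ler_piMr // cos_max.
Qed.

(** Keeping in [q] exactly the nodes at distance at least 1 from [- a] makes [|q(- a)|] the full
    product of [max(1, a + t_m)], with logarithm [n I] up to [c]. *)
Lemma factor_constants_segment_ge (R : realType) (a I c C : R) : 0 < a ->
  (forall n, (0 < n)%N ->
    `|\sum_(0 <= m < n) logp_cos R a (cheb_angle R n m) - n%:R * I| <= c) ->
  factor_constants (real_segment (- a) a) C -> 2 / a * expR I <= C.
Proof.
move=> a0 Ic [C0 CP]; rewrite mulrC -ler_pdivlMr ?divr_gt0 // invf_div.
(* The 2 comes from the Chebyshev norm [2 (a / 2)^n], and [expR c] from the error of the node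
   sum. *)
apply: (ler_of_powers _ _ _ (2 * expR c)).
- exact: expR_ge0.
- by rewrite mulr_ge0 ?divr_ge0 // ltW.
move=> n n0; pose t m := cheb_node R a n m.
pose X m : {poly R[i]} := 'X - ((t m)%:C%C)%:P.
pose p := \prod_(m <- iota 0 n) X m.
pose q := \prod_(m <- iota 0 n | 1 <= a + t m) X m.
pose r := \prod_(m <- iota 0 n | ~~ (1 <= a + t m)) X m.
have pE : p = q * r by rewrite /p (bigID (fun m => 1 <= a + t m)).
have pmon : p \is monic by apply: monic_prod => m _; exact: monicXsubC.
have qmon : q \is monic by apply: monic_prod => m _; exact: monicXsubC.
have rmon : r \is monic by apply: monic_prod => m _; exact: monicXsubC.
have sp : (size p).-1 = n.
  by rewrite /p (size_prod_XsubC _ (fun m => (t m)%:C%C)) size_iota.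
have := CP p q pmon (conj qmon (ex_intro _ r (conj rmon pE))); rewrite sp => qp.
have qa : normc q.[((- a)%:C)%C] = \prod_(m <- iota 0 n) Num.max 1 (a + t m).
  rewrite [RHS](bigID (fun m => 1 <= a + t m)) /=.
  rewrite [X in _ * X]big1 ?mulr1; last first.
    by move=> m; rewrite -ltNge => /ltW m1; rewrite max_l.
  rewrite /q horner_prod big_mkcond [RHS]big_mkcond normc_prod.
  apply: eq_bigr => m _; case: ifP => m1; last by rewrite normc1.
  rewrite hornerXsubC -rmorphB normc_real -opprD normrN max_r //.
  by rewrite ger0_norm // (le_trans ler01).
have le_q : \prod_(m <- iota 0 n) Num.max 1 (a + t m) <= C ^+ n * (2 * (a / 2) ^+ n).
  rewrite -qa (le_trans (poly_norm_ge R a _ q _)) ?normrN ?gtr0_norm //.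
  apply: (le_trans qp); rewrite ler_wpM2l ?exprn_ge0 ?(ltW C0) //.
  exact: chebyshev_poly_norm.
have iotaE : iota 0 n = index_iota 0 n by rewrite /index_iota subn0.
move: le_q; rewrite iotaE.
under [X in X <= _ -> _]eq_bigr do rewrite -expR_logp.
rewrite -expR_sum => le_q.
have : expR I ^+ n <= expR c * expR (\sum_(0 <= m < n) logp R (a + t m)).
  rewrite -expRM_natl -expRD ler_expR.
  have := Ic n n0; rewrite ler_norml => /andP[h _].
  have {}h : - c <= \sum_(0 <= m < n) logp R (a + t m) - n%:R * I by exact: h.
  by lra.
move=> /le_trans; apply.
apply: le_trans (ler_wpM2l (expR_ge0 _) le_q) _.
rewrite [(C * _) ^+ n]exprMn le_eqVlt; apply/orP; left; apply/eqP; ring.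
Qed.

(** For [a <= 1 / 2] every [a + a cos t] is at most 1 and the sum is zero; otherwise the Riemann sum
    estimate applies with the value of the arcsine integral. *)
Lemma logp_cos_mean (R : realType) (a : R) : 0 < a ->
  let I := if a <= 1 / 2 then 0
           else \int[lebesgue_measure]_(t in `[1 - a, a]) arcsine_log R a t in
  forall n, (0 < n)%N ->
    `|\sum_(0 <= m < n) logp_cos R a (cheb_angle R n m) - n%:R * I| <= a * pi.
Proof.
move=> a0 I n n0; rewrite /I; case: ifPn => [a12|].
  rewrite mulr0 subr0 big1 ?normr0 ?mulr_ge0 ?pi_ge0 ?(ltW a0) // => m _.
  rewrite /logp_cos logp_le1 //.
  have := ler_wpM2l (ltW a0) (cos_le1 (cheb_angle R n m)); lra.
rewrite -ltNge => a12; have [F dF] := logp_cos_antiderivative R a a0.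
by rewrite (arcsine_log_integral R a F) //; exact: logp_cos_riemann.
Qed.

Theorem corollary3p3 (R : realType) (a : R) (ha : 0 < a) :
  is_smallest_factor_constant (real_segment (- a) a)
    (if a <= 1 / 2 then 2 / a
     else 2 / a *
       expR (\int[lebesgue_measure]_(t in `[1 - a, a])
               (ln (t + a) / (pi * Num.sqrt (a ^+ 2 - t ^+ 2))))).
Proof.
have mean := logp_cos_mean R a ha.
have -> : (if a <= 1 / 2 then 2 / a
     else 2 / a *
       expR (\int[lebesgue_measure]_(t in `[1 - a, a])
               (ln (t + a) / (pi * Num.sqrt (a ^+ 2 - t ^+ 2))))) =
  2 / a * expR (if a <= 1 / 2 then 0
           else \int[lebesgue_measure]_(t in `[1 - a, a]) arcsine_log R a t).
  by case: ifP => // _; rewrite expR0 mulr1.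
split; first exact: factor_constants_segment mean.
by move=> C; exact: factor_constants_segment_ge mean.
Qed.
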